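(* Let $0<r_j<\infty$, $0<s_j<\infty$ for $j=1,\dots,n$, let $\mathbf{u}_1,\mathbf{u}_2\in\mathbb{C}^n$, and let $\rho=W(\mathbf{u}_1)\gamma(\mathbf{r})W(\mathbf{u}_1)^\dagger$ and $\sigma=W(\mathbf{u}_2)\gamma(\mathbf{s})W(\mathbf{u}_2)^\dagger$, where $\gamma(\mathbf{r})=\otimes_{j}\gamma(r_j)$, $\gamma(\mathbf{s})=\otimes_j\gamma(s_j)$. Let $\alpha>1$ and let $V_{\sigma(\alpha-1)}$ and $V_{\rho(\alpha)}$ denote the covariance matrices of the gaussian states $\sigma^{\alpha-1}/\operatorname{tr}\sigma^{\alpha-1}$ and $\rho^\alpha/\operatorname{tr}\rho^\alpha$ respectively. If $D_\alpha(\rho\|\sigma)<\infty$, then $V_{\sigma(\alpha-1)}>V_{\rho(\alpha)}$.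
   Context: One-mode Fock space: $\ell^2(\mathbb{Z}_{\ge 0})$ with orthonormal particle basis $\{|k\rangle\}$; $n$-mode space is the $n$-fold tensor product. For $0<s<\infty$, $\gamma(s)=(1-e^{-s})\sum_{k\ge0}e^{-ks}|k\rangle\langle k|$. For $u\in\mathbb{C}$, $|e(v)\rangle=\sum_k\frac{v^k}{\sqrt{k!}}|k\rangle$ and $W(u)$ is the unitary with $W(u)|e(v)\rangle=\exp(-\tfrac12|u|^2-\bar uv)|e(u+v)\rangle$; $W(\mathbf{u})=W(u_1)\otimes\cdots\otimes W(u_n)$. For $\beta>0$, $\gamma(\mathbf{s})^\beta/\operatorname{tr}\gamma(\mathbf{s})^\beta=\gamma(\beta\mathbf{s})$, and the covariance matrix of $\gamma(\mathbf{s})$ (and of any displacement $W(\mathbf{u})\gamma(\mathbf{s})W(\mathbf{u})^\dagger$) is the $2n\times2n$ matrix $\frac12\operatorname{diag}(\coth\frac{s_1}{2},\dots,\coth\frac{s_n}{2})\otimes I_2$. For real symmetric matrices, $A>B$ means $A-B$ is positive definite. For states $\rho=\sum_i p_i|x_i\rangle\langle x_i|$, $\sigma=\sum_j q_j|y_j\rangle\langle y_j|$ (spectral decompositions), $D_\alpha(\rho\|\sigma)=\frac{1}{\alpha-1}\log\sum_{i,j}p_i^\alpha q_j^{1-\alpha}|\langle x_i|y_j\rangle|^2$ for $\alpha\in(0,1)\cup(1,\infty)$, with conventions $0^{1-\alpha}=\infty$ ($\alpha>1$) and $0\cdot\infty=0$. *)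

(* Defs.v *)
From HB Require Import structures.
From mathcomp Require Import all_boot all_order all_algebra.
From mathcomp Require Import all_classical all_reals all_analysis.
From mathcomp Require Import complex mxtens.
Set Implicit Arguments. Unset Strict Implicit. Unset Printing Implicit Defensive.
Import Order.TTheory GRing.Theory Num.Theory.
Import numFieldNormedType.Exports.
Local Open Scope ring_scope.

(* One-mode Fock space l^2(Z_{>=0}) with particle basis |k>, k : nat.  *)
(* The Weyl operator W(u) is determined by its matrix elements         *)
(* <k|W(u)|l> in the particle basis.  From the defining relation       *)
(*   W(u)|e(v)> = exp(-|u|^2/2 - conj(u) v) |e(u+v)>,                  *)
(*   |e(v)> = sum_k v^k/sqrt(k!) |k>,                                  *)
(* one gets <e(a)|W(u)|e(v)> = exp(-|u|^2/2 + conj(a) u - conj(u) v    *)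
(*   + conj(a) v) = sum_{k,l} conj(a)^k v^l / sqrt(k! l!) <k|W(u)|l>,  *)
(* and comparing coefficients of conj(a)^k v^l gives:                  *)
(*   <k|W(u)|l> = exp(-|u|^2/2) sqrt(k! l!)                            *)
(*     * sum_{m=0}^{min(k,l)} u^(k-m) (-conj u)^(l-m)                  *)
(*                             / ((k-m)! (l-m)! m!).                    *)
Definition weyl_el (R : realType) (u : R[i]) (k l : nat) : R[i] :=
  (expR (- (Normc.normc u ^+ 2) / 2))%:C%C
  * (Num.sqrt ((k`! * l`!)%N%:R : R))%:C%C
  * \sum_(m < (minn k l).+1)
      (u ^+ (k - m) * (- conjc u) ^+ (l - m)
       / (((k - m)`! * (l - m)`! * m`!)%N%:R)).

Definition weyl_inner1 (R : realType) (a b : R[i]) (k l : nat) : R[i] :=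
  limn (series ((fun m => conjc (weyl_el a m k) * weyl_el b m l)
                 : nat -> (R[i])^o)).

(* n-mode particle basis |k> = |k_1> (x) ... (x) |k_n>, indexed by    *)
(* k : {ffun 'I_n -> nat}; W(u) = W(u_1) (x) ... (x) W(u_n).           *)
(* Inner product of product vectors = product of one-mode inner        *)
(* products:  <W(u1)k | W(u2)l>.                                       *)
Definition weyl_overlap (R : realType) (n : nat) (u1 u2 : 'I_n -> R[i])
  (k l : {ffun 'I_n -> nat}) : R[i] :=
  \prod_(j < n) weyl_inner1 (u1 j) (u2 j) (k j) (l j).

(* Eigenvalue of gamma(s) = (x)_j gamma(s_j) on |k> :                  *)
Definition therm_ev (R : realType) (n : nat) (s : 'I_n -> R)
  (k : {ffun 'I_n -> nat}) : R :=
  \prod_(j < n) ((1 - expR (- s j)) * expR (- ((k j)%:R * s j))).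

(* Renyi divergence from spectral decompositions                       *)
(*   rho = sum_i p_i |x_i><x_i|,  sigma = sum_j q_j |y_j><y_j|,        *)
(* with overlaps ov i j = <x_i|y_j>:                                   *)
(*   D_alpha = 1/(alpha-1) log sum_{i,j} p_i^alpha q_j^(1-alpha)       *)
(*             |<x_i|y_j>|^2,                                          *)
(* conventions 0^(1-alpha) = +oo (alpha > 1) and 0 * oo = 0 (the       *)
(* latter is mathcomp's convention for extended-real multiplication).  *)
Section Renyi.
Local Open Scope ereal_scope.
Variables (R : realType) (I J : choiceType).

Definition renyi_term (alpha : R) (p : I -> R) (q : J -> R)
  (ov : I -> J -> R[i]) (ij : I * J) : \bar R :=
  let a := ((p ij.1) `^ alpha)%R in
  let b := if q ij.2 == 0%R then
             (if (1 < alpha)%R then +oo else 0)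
           else ((q ij.2) `^ (1 - alpha))%:E in
  a%:E * b * ((Normc.normc (ov ij.1 ij.2)) ^+ 2)%:E.

Definition renyi_sum (alpha : R) (p : I -> R) (q : J -> R)
  (ov : I -> J -> R[i]) : \bar R :=
  esum setT (renyi_term alpha p q ov).

Definition renyi_div (alpha : R) (p : I -> R) (q : J -> R)
  (ov : I -> J -> R[i]) : \bar R :=
  match renyi_sum alpha p q ov with
  | x%:E => if x == 0%R then (if (1 < alpha)%R then -oo else +oo)
            else (ln x / (alpha - 1))%:E
  | +oo => if (1 < alpha)%R then +oo else -oo
  | -oo => -oo
  end.
End Renyi.

(* The covariance matrix of gamma(s) and of every displaced state      *)
(* W(u) gamma(s) W(u)^dagger is (1/2) diag(coth(s_j/2)) (x) I_2,       *)
(* a 2n x 2n matrix (here indexed by 'I_(n * 2)).                      *)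
Definition coth (R : realType) (x : R) : R :=
  (expR x + expR (- x)) / (expR x - expR (- x)).

Definition gauss_cov (R : realType) (n : nat) (s : 'I_n -> R) : 'M[R]_(n * 2) :=
  (2^-1) *: (diag_mx (\row_j coth (s j / 2)) *t (1%:M : 'M[R]_2)).

(* For beta > 0, gamma(s)^beta / tr gamma(s)^beta = gamma(beta s), and *)
(* (W gamma(s) W^dag)^beta / tr = W gamma(beta s) W^dag; hence the     *)
(* covariance matrix of  rho^beta / tr rho^beta  for                   *)
(* rho = W(u) gamma(s) W(u)^dag is:                                    *)
Definition cov_power (R : realType) (n : nat) (beta : R) (s : 'I_n -> R)
  : 'M[R]_(n * 2) :=
  gauss_cov (fun j => beta * s j).

Definition posdef (R : realType) (m : nat) (M : 'M[R]_m) : Prop :=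
  forall x : 'cV[R]_m, x != 0 -> 0 < (x^T *m M *m x) ord0 ord0.

Definition mx_gt (R : realType) (m : nat) (A B : 'M[R]_m) : Prop :=
  posdef (A - B).

(* Main.v *)
(* If alpha r_j >= (alpha - 1) s_j for some j, the Renyi sum diverges already
   on the indices (k, l) supported on mode j.  Up to a positive factor these
   terms are x^k y^l |<k|W(u)|l>|^2 with u = u2_j - u1_j, x = exp(- alpha r_j),
   y = exp((alpha - 1) s_j), so y >= 1 and x y >= 1.  The Cauchy-Schwarz
   inequality against a coherent state, whose amplitude is optimised for k,
   gives sum_l y^l |<k|W(u)|l>|^2 >= y^k k^k e^(-k) / k!, and
   k^k e^(-k) / k! >= 1 / (e k), so the harmonic series bounds the sum from
   below.  Hence alpha r_j < (alpha - 1) s_j for all j, and coth is decreasing. *)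

Require Import Defs.
From HB Require Import structures.
From mathcomp Require Import all_boot all_order all_algebra.
From mathcomp Require Import all_classical all_reals all_analysis.
From mathcomp Require Import complex mxtens.
From mathcomp Require Import ring lra.
Set Implicit Arguments.
Unset Strict Implicit.
Unset Printing Implicit Defensive.
Import Order.TTheory GRing.Theory Num.Theory.
Import numFieldNormedType.Exports.
Local Open Scope classical_set_scope.
Local Open Scope ring_scope.

(** * Matrix elements of Weyl operators: recurrences and scaling *)

(* Vanishing for j > m lets sums over j run past m. *)
Definition divpow {K : fieldType} (u : K) (m j : nat) : K :=
  if (j <= m)%N then u ^+ (m - j) / (m - j)`!%:R else 0.

(* Coefficient of X^k Y^l in exp(uX + vY + XY); for v = - conj u it is <k|W(u)|l>
   without the factor exp(-|u|^2/2) sqrt(k! l!). *)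
Definition wker {K : fieldType} (u v : K) (k l : nat) : K :=
  \sum_(j < (minn k l).+1)
     u ^+ (k - j) * v ^+ (l - j) / ((k - j)`! * (l - j)`! * j`!)%N%:R.

Section Wker.
Variable K : numFieldType.
Implicit Types (u v : K) (k l m : nat).

Lemma factr_neq0 m : m`!%:R != 0 :> K.
Proof. by rewrite pnatr_eq0 -lt0n fact_gt0. Qed.

(** A common range [N] lets matrix elements with different indices be compared term by term. *)
Lemma wker_divpow u v k l N : (minn k l < N)%N ->
  wker u v k l = \sum_(j < N) divpow u k j * divpow v l j / j`!%:R.
Proof.
move=> hN; rewrite /wker.
rewrite (big_ord_widen N (fun j => u ^+ (k - j) * v ^+ (l - j) /
  ((k - j)`! * (l - j)`! * j`!)%N%:R)) // big_mkcond.
apply: eq_bigr => j _; rewrite /divpow ltnS leq_min.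
case: (j <= k)%N => /=; last by rewrite !mul0r.
case: (j <= l)%N => /=; last by rewrite mulr0 mul0r.
rewrite !natrM; field.
by rewrite !factr_neq0.
Qed.

Lemma wkerC u v k l : wker u v k l = wker v u l k.
Proof.
rewrite /wker minnC; apply: eq_bigr => j _.
by rewrite [u ^+ _ * _]mulrC [((k - j)`! * _)%N]mulnC.
Qed.

Lemma wker00 u v : wker u v 0 0 = 1.
Proof. by rewrite /wker big_ord_recl big_ord0 /= !expr0 !fact0 divr1 mulr1 addr0. Qed.

Lemma divpow0S u j : divpow u 0 j.+1 = 0.
Proof. by []. Qed.

Lemma divpowSS u m j : divpow u m.+1 j.+1 = divpow u m j.
Proof. by rewrite /divpow ltnS subSS. Qed.

(** Write m + 1 as (m + 1 - j) + j: the first summand cancels the top factor of the factorial. At j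
    = m + 1 the term in u vanishes and the identity is trivial. *)
Lemma divpowS u m j :
  m.+1%:R * divpow u m.+1 j = u * divpow u m j + j%:R * divpow u m.+1 j.
Proof.
rewrite /divpow; case: (leqP j m) => hjm.
  have ->: (j <= m.+1)%N by exact: leqW.
  rewrite subSn // factS natrM exprS.
  have -> : m.+1%:R = (m - j).+1%:R + j%:R :> K by rewrite -natrD addSn subnK.
  by field; rewrite factr_neq0 /= -[1]/(1%:R) -natrD pnatr_eq0.
rewrite mulr0 add0r; have [->//|ne] := eqVneq j m.+1.
by rewrite leqNgt ltn_neqAle eq_sym ne hjm /= !mulr0.
Qed.

(** Coefficient form of d/dX exp(uX + vY + XY) = (u + Y) exp(uX + vY + XY). *)
Lemma wkerS u v k l :
  k.+1%:R * wker u v k.+1 l =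
  u * wker u v k l + (if l is l'.+1 then wker u v k l' else 0).
Proof.
have hN : (minn k.+1 l < k.+2)%N by rewrite ltnS geq_minl.
have hN1 : (minn k l < k.+2)%N by rewrite ltnS (leq_trans (geq_minl _ _)).
rewrite (wker_divpow _ _ hN) (wker_divpow _ _ hN1) !mulr_sumr.
under eq_bigr do rewrite 2!mulrA divpowS 2!mulrDl.
rewrite big_split /=; congr (_ + _).
  by apply: eq_bigr => i _; rewrite !mulrA.
(* The factor j kills the term j = 0; in the other terms it cancels against the factorial of j, and
   shifting j leaves the sum for l - 1. *)
rewrite big_ord_recl !mul0r add0r.
case: l {hN hN1} => [|l].
  by rewrite big1 // => i _; rewrite lift0 divpow0S mulr0 mul0r.
rewrite (@wker_divpow _ _ _ _ k.+1) ?ltnS ?geq_minl //.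
apply: eq_bigr => i _; rewrite lift0 !divpowSS factS natrM.
by field; rewrite factr_neq0 /= -[1]/(1%:R) -natrD pnatr_eq0.
Qed.

Lemma wkerSr u v k l :
  l.+1%:R * wker u v k l.+1 =
  v * wker u v k l + (if k is k'.+1 then wker u v k' l else 0).
Proof.
rewrite wkerC wkerS wkerC; congr (_ + _).
by case: k => // k; rewrite wkerC.
Qed.

(** The substitution X -> aX, Y -> bY preserves XY when ab = 1, so it only rescales u and v. *)
Lemma wker_scale a b u v k l : a * b = 1 ->
  wker (a * u) (b * v) k l = a ^+ k * b ^+ l * wker u v k l.
Proof.
move=> ab; rewrite /wker mulr_sumr; apply: eq_bigr => j _.
rewrite !mulrA; congr (_ / _).
have /andP[hk hl] : (j <= k)%N && (j <= l)%N by rewrite -leq_min -ltnS.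
have ha : a ^+ k = a ^+ (k - j) * a ^+ j by rewrite -exprD subnK.
have hb : b ^+ l = b ^+ (l - j) * b ^+ j by rewrite -exprD subnK.
have hab : a ^+ j * b ^+ j = 1 by rewrite -exprMn ab expr1n.
by rewrite !exprMn ha hb; ring: hab.
Qed.

End Wker.

Lemma wker_rmorph (K L : numFieldType) (f : {rmorphism K -> L}) (u v : K) k l :
  wker (f u) (f v) k l = f (wker u v k l).
Proof.
rewrite /wker rmorph_sum; apply: eq_bigr => j _.
by rewrite fmorph_div rmorphM !rmorphXn /= rmorph_nat.
Qed.

(** * Composition of two Weyl operators as a convergent series *)

Lemma cvg_series_shift (K : numFieldType) (f : nat -> K^o) (L : K^o) :
  series f @ \oo --> L ->
  series (fun m => if m is m'.+1 then f m' else 0 : K^o) @ \oo --> L.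
Proof.
move=> h; rewrite -cvg_shiftS /=.
apply: cvg_trans h; apply: near_eq_cvg; near=> n.
by rewrite /series /= big_nat_recl //= add0r.
Unshelve. all: by end_near.
Qed.

Lemma cvg_seriesZ (K : numFieldType) (a : K) (f : nat -> K^o) (L : K^o) :
  series f @ \oo --> L -> series (fun m => a * f m : K^o) @ \oo --> (a * L : K^o).
Proof.
move=> h; have -> : series (fun m => a * f m : K^o) = a \*: series f.
  by apply/funext => n; rewrite /series /= -scaler_sumr.
exact: cvgZl_tmp.
Qed.

Lemma cvg_seriesD (K : numFieldType) (f g : nat -> K^o) (L M : K^o) :
  series f @ \oo --> L -> series g @ \oo --> M ->
  series (fun m => f m + g m) @ \oo --> L + M.
Proof. by move=> hf hg; rewrite (seriesD f g); exact: cvgD. Qed.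

(* W(u1)^dag W(u2) is W(u2 - u1) up to a scalar: the recurrences wkerS and
   wkerSr pass to the sum over m, which reduces everything to k = l = 0. *)
Lemma cvg_series_wker_mul (K : numFieldType) (u v u' v' : K) (E : K^o) :
  series (fun m => (u * u') ^+ m / m`!%:R : K^o) @ \oo --> E ->
  forall k l,
  series (fun m => m`!%:R * wker u v m k * wker u' v' m l : K^o) @ \oo -->
    (E * wker (v + u') (v' + u) k l : K^o).
Proof.
move=> hE k l.
have wk0 k0 : (k0.+1%:R != 0 :> K) by rewrite pnatr_eq0.
pose T k l m : K^o := m`!%:R * wker u v m k * wker u' v' m l.
pose W k l : K := wker (v + u') (v' + u) k l.
pose prev (f : nat -> K) k := if k is k'.+1 then f k' else 0.
rewrite -/(W k l); change (series (T k l) @ \oo --> (E * W k l : K^o)).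
(* [wkerSr] on the second factor produces the index m - 1; the factor m of m! then feeds [wkerS] on
   the first factor, so every term is again a value of [T]. *)
have recr p q m : T p q.+1 m = q.+1%:R^-1 * (v' * T p q m +
    (if m is m'.+1 then u * T p q m' + prev (fun p' => T p' q m') p else 0)).
  apply: (mulfI (wk0 q)); rewrite [RHS]mulrA mulfV // mul1r /T mulrCA wkerSr mulrDr.
  congr (_ + _); first by ring.
  case: m => [|m]; first by rewrite mulr0.
  have := wkerS u v m p; rewrite factS natrM.
  by move: (m.+1%:R : K) => c; rewrite /prev; case: p => [|p] /= h; ring: h.
have recl p m : T p.+1 0 m = p.+1%:R^-1 * (v * T p 0 m +
    (if m is m'.+1 then u' * T p 0 m' else 0)).
  apply: (mulfI (wk0 p)); rewrite [RHS]mulrA mulfV // mul1r /T.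
  rewrite mulrA [_ * (_ * _)]mulrCA wkerSr mulrDr mulrDl.
  congr (_ + _); first by ring.
  case: m => [|m]; first by rewrite mulr0 mul0r.
  have := wkerS u' v' m 0; rewrite addr0 factS natrM.
  by move: (m.+1%:R : K) => c h; ring: h.
(* The step in l uses the hypothesis at k and at k - 1, so k stays general; the base l = 0 is a
   separate induction on k, through [recl]. *)
elim: l k => [|l IHl] k.
  elim: k => [|k IHk].
    rewrite /W wker00 mulr1; apply: cvg_trans hE; apply: near_eq_cvg.
    apply: nearW => n; apply: eq_bigr => m _; rewrite /T.
    have wm0 x y : wker x y m 0 = x ^+ m / m`!%:R.
      rewrite /wker minn0 big_ord_recl big_ord0 /= !subn0 fact0 !muln1.
      by rewrite mulr1 addr0.
    rewrite !wm0 exprMn; field; exact: factr_neq0.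
  have -> : (E * W k.+1 0%N : K) = k.+1%:R^-1 * (v * (E * W k 0%N) + u' * (E * W k 0%N)).
    apply: (mulfI (wk0 k)); rewrite [RHS]mulrA mulfV // mul1r.
    by rewrite mulrCA /W wkerS addr0; ring.
  rewrite (_ : T _ _ = fun m => k.+1%:R^-1 * (v * T k 0 m +
    (if m is m'.+1 then u' * T k 0 m' else 0))); last first.
    by apply/funext => m; rewrite recl.
  apply: cvg_seriesZ; apply: cvg_seriesD; first exact: cvg_seriesZ.
  by apply: cvg_series_shift; exact: cvg_seriesZ.
have -> : (E * W k l.+1 : K) = l.+1%:R^-1 * (v' * (E * W k l) +
   (u * (E * W k l) + prev (fun p => E * W p l) k)).
  apply: (mulfI (wk0 l)); rewrite [RHS]mulrA mulfV // mul1r.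
  by rewrite mulrCA /W wkerSr /prev; case: k => [|k] /=; ring.
rewrite (_ : T _ _ = fun m => l.+1%:R^-1 * (v' * T k l m +
    (if m is m'.+1 then u * T k l m' + prev (fun p => T p l m') k else 0)));
  last by apply/funext => m; exact: recr.
apply: cvg_seriesZ; apply: cvg_seriesD; first exact: cvg_seriesZ.
apply: (@cvg_series_shift _ (fun m => u * T k l m + prev (fun p' => T p' l m) k)).
apply: cvg_seriesD; first exact: cvg_seriesZ.
rewrite /prev; case: k => [|k] /=; last exact: IHl.
rewrite (_ : series _ = fun=> 0); first exact: cvg_cst.
by apply/funext => n; rewrite /series /= big1.
Qed.

(** * Partial sums of the exponential and nonvanishing of the complex exponential *)

Definition expsum {K : fieldType} (N : nat) (z : K) : K :=
  \sum_(i < N) z ^+ i / i`!%:R.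

(** The binomial theorem gives a sum over the triangle i + j < N, sliced here by i. *)
Lemma expsumD (K : numFieldType) N (a b : K) :
  expsum N (a + b) = \sum_(i < N) a ^+ i / i`!%:R * expsum (N - i) b.
Proof.
pose F i j : K := a ^+ i / i`!%:R * (b ^+ j / j`!%:R).
transitivity (\sum_(n < N) \sum_(i < N | (i < n.+1)%N) F i (n - i)%N).
  apply: eq_bigr => n _; rewrite addrC exprDn mulr_suml.
  rewrite -(big_ord_widen N (fun i => F i (n - i)%N)) //.
  apply: eq_bigr => i _; rewrite /F -mulr_natr.
  have le : (i <= n)%N by rewrite -ltnS.
  have h : ('C(n, i) * i`! * (n - i)`! = n`!)%N by rewrite -mulnA bin_fact.
  rewrite -h !natrM; field.
  by rewrite !factr_neq0 /= pnatr_eq0 -lt0n bin_gt0.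
rewrite (exchange_big_dep xpredT) //=; apply: eq_bigr => i _.
rewrite /expsum mulr_sumr.
rewrite -(big_mkord (fun n => (i < n.+1)%N) (fun n => F i (n - i)%N)).
rewrite -(big_mkord xpredT (fun j => F i j)).
rewrite (@big_cat_nat _ _ _ i) //=; last exact: ltnW.
rewrite big_nat_cond big1 ?add0r => [|n /andP[/andP[_ h]]]; last first.
  by rewrite ltnS leqNgt h.
rewrite big_nat_cond -[X in \sum_(X <= _ < _ | _) _](add0n i) big_addn.
rewrite [RHS]big_nat_cond [LHS]big_nat_cond; apply: eq_big => [j|j _].
  by rewrite ltnS leq0n /= leq_addl /= andbT ltn_subRL addnC; case: (_ < _)%N.
by rewrite addnK.
Qed.

Lemma norm_expsumB (K : numFieldType) m n (z : K) : (m <= n)%N ->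
  `|expsum n z - expsum m z| <= expsum n `|z| - expsum m `|z|.
Proof.
have E (x : K) : (m <= n)%N ->
    expsum n x - expsum m x = \sum_(m <= i < n) x ^+ i / i`!%:R.
  move=> mn; rewrite /expsum -!(big_mkord xpredT (fun i => x ^+ i / i`!%:R)).
  by rewrite (@big_cat_nat _ _ _ m 0 n) //= [LHS]addrC addKr.
move=> mn; rewrite !E //; apply: le_trans (ler_norm_sum _ _ _) _.
by apply: ler_sum => i _; rewrite normrM normrX normfV normr_nat.
Qed.

(** Removing the triangle i + j < N from the square of indices leaves terms with nonnegative
    coefficients, so passing to moduli can only enlarge the sum. *)
Lemma norm_expsumM (K : numFieldType) N (a b : K) :
  `|expsum N a * expsum N b - expsum N (a + b)| <=
  expsum N `|a| * expsum N `|b| - expsum N (`|a| + `|b|).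
Proof.
rewrite !expsumD {1 3}/expsum !mulr_suml -!sumrB.
apply: le_trans (ler_norm_sum _ _ _) _; apply: ler_sum => i _.
rewrite -!mulrBr !normrM normfV normrX normr_nat ler_wpM2l //.
by apply: norm_expsumB; exact: leq_subr.
Qed.

Lemma cvg_expsum (R : realType) (x : R) : expsum n x @[n --> \oo] --> expR x.
Proof.
have -> : (fun n => expsum n x) = series (exp_coeff x).
  by apply/funext => n; rewrite /series /= big_mkord.
exact: is_cvg_series_exp_coeff.
Qed.

Lemma normc_complex (R : rcfType) (z : R[i]) : `|z| = (Normc.normc z)%:C%C.
Proof. by case: z. Qed.

Lemma normc_ge0 (R : rcfType) (z : R[i]) : 0 <= Normc.normc z.
Proof. by case: z => a b; exact: sqrtr_ge0. Qed.

Lemma cvg_complex (R : realType) (x y : nat -> R) (a b : R) :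
  x @ \oo --> a -> y @ \oo --> b ->
  (fun n => (Complex (x n) (y n) : R[i]^o)) @ \oo --> (Complex a b : R[i]^o).
Proof.
move=> /cvgrPdist_lt hx /cvgrPdist_lt hy; apply/cvgrPdist_lt => e e0.
(* Positivity in [R[i]] forces a zero imaginary part, so epsilon is real. *)
have [r r0 ->] : exists2 r : R, 0 < r & e = r%:C%C.
  case: e e0 => p q; rewrite ltcE /= => /andP[/eqP -> p0].
  by exists p.
have r2 : 0 < r / 2 by rewrite divr_gt0.
near=> n.
rewrite (_ : _ - _ = (a - x n)%:C%C + 'i%C * (b - y n)%:C%C); last first.
  by apply/eqP; rewrite eq_complex /= !(mul0r, mul1r, subr0, addr0, add0r) !eqxx.
apply: le_lt_trans (ler_normD _ _) _; rewrite normrM.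
rewrite !normc_complex /= !expr0n /= !expr1n !addr0 add0r sqrtr1.
rewrite -rmorphM -rmorphD /= ltcR !sqrtr_sqr mul1r.
rewrite [r]splitr; apply: ltrD.
- by near: n; exact: (hx _ r2).
- by near: n; exact: (hy _ r2).
Unshelve. all: by end_near.
Qed.

Lemma expsum_real_complex (R : realType) N (x : R) :
  expsum N x%:C%C = (expsum N x)%:C%C.
Proof.
rewrite /expsum rmorph_sum; apply: eq_bigr => i _.
by rewrite fmorph_div rmorphXn /= rmorph_nat.
Qed.

(** The limit is exp(z); that it is nonzero makes the constant of [normc_weyl_inner1] positive. *)
Lemma cvg_expsum_complex (R : realType) (z : R[i]) :
  exists2 E : R[i], E != 0 &
    (fun n => expsum n z : R[i]^o) @ \oo --> (E : R[i]^o).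
Proof.
pose t (n : nat) : R[i] := z ^+ n / n`!%:R.
have nt n : Normc.normc (t n) = exp_coeff (Normc.normc z) n.
  apply: complexI; rewrite -normc_complex /t normrM normfV normrX normr_nat.
  by rewrite normc_complex fmorph_div rmorphXn /= rmorph_nat.
(* Real and imaginary parts are dominated by the modulus, whose series is a real exponential
   series. *)
have cvg_part (p : R[i] -> R) : (forall w, `|p w| <= Normc.normc w) ->
    cvgn (series (fun n => p (t n))).
  move=> hp; apply: normed_cvg.
  apply: (@series_le_cvg _ _ (exp_coeff (Normc.normc z))).
  - by move=> n; exact: normr_ge0.
  - by move=> n; apply: exp_coeff_ge0; exact: normc_ge0.
  - by move=> n; rewrite -nt; exact: hp.
  - exact: is_cvg_series_exp_coeff.
have hRe : cvgn (series (fun n => complex.Re (t n))).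
  apply: cvg_part => -[a b] /=; rewrite -sqrtr_sqr ler_sqrt ?addr_ge0 ?sqr_ge0//.
  by rewrite lerDl sqr_ge0.
have hIm : cvgn (series (fun n => complex.Im (t n))).
  apply: cvg_part => -[a b] /=; rewrite -sqrtr_sqr ler_sqrt ?addr_ge0 ?sqr_ge0//.
  by rewrite lerDr sqr_ge0.
have eq_expsum n : expsum n z =
    Complex (series (fun n => complex.Re (t n)) n) (series (fun n => complex.Im (t n)) n).
  elim: n => [|n IH].
    by rewrite /expsum /series /= !big_nil big_ord0.
  rewrite /expsum big_ord_recr /= -/(expsum n z) IH /series /= !big_nat_recr //=.
  by rewrite -/(t n); case: (t n).
have := cvg_complex hRe hIm; set E := Complex _ _ => hE.
have {}hE : (fun n => expsum n z : R[i]^o) @ \oo --> (E : R[i]^o).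
  by apply: cvg_trans hE; apply: near_eq_cvg; apply: nearW => n; rewrite eq_expsum.
(* The product of the partial sums at z and -z differs from 1 by at most the
   analogous difference at |z|, |z|, which tends to exp(2|z|) - exp(2|z|) = 0. *)
exists E => //; apply/eqP => E0.
pose r := Normc.normc z.
have r0 : 0 <= r by exact: normc_ge0.
have hD : (fun n => expsum n r * expsum n r - expsum n (r + r)) @ \oo --> (0 : R).
  rewrite -[X in _ --> X](subrr (expR (r + r))) {1}expRD.
  by apply: cvgB; [apply: cvgM|]; exact: cvg_expsum.
(* If [expsum n z] is below this bound and [expsum n (- z)] is at most exp(r) in modulus, their
   product has modulus at most 1/2 and stays at distance at least 1/2 from 1. *)
have e0 : 0 < (expR r)^-1 / 2 by rewrite divr_gt0 ?invr_gt0 ?expR_gt0.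
have e0C : 0 < ((expR r)^-1 / 2)%:C%C :> R[i] by rewrite ltcR.
have le_exp n : expsum n r <= expR r.
  rewrite -(cvg_lim (@Rhausdorff R) (cvg_expsum (x := r))).
  apply: (nondecreasing_cvgn_le (u_ := fun n => expsum n r)); last first.
    by apply/cvg_ex; exists (expR r); exact: cvg_expsum.
  apply/nondecreasing_seqP => m; rewrite /expsum big_ord_recr /= lerDl.
  exact: exp_coeff_ge0.
have half0 : 0 < 2^-1 :> R by rewrite invr_gt0.
(* Only the constant term survives at 0, and the empty sum [expsum 0] does not contain it. *)
have exp0 m : (0 < m)%N -> expsum m (z + - z) = 1.
  case: m => // m _.
  rewrite subrr /expsum big_ord_recl expr0 fact0 divr1 big1 ?addr0 // => i _.
  by rewrite expr0n mul0r.
near \oo => n.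
have n0 : (0 < n)%N by near: n; exact: nbhs_infty_gt.
have h1 : Normc.normc (expsum n z) < (expR r)^-1 / 2.
  rewrite -ltcR -normc_complex; near: n.
  move/cvgrPdist_lt : hE => /(_ _ e0C); rewrite E0.
  by apply: filterS => m; rewrite sub0r normrN.
have h2 : expsum n r * expsum n r - expsum n (r + r) < 2^-1.
  apply: le_lt_trans (ler_norm _) _; near: n.
  move/cvgrPdist_lt : hD => /(_ _ half0).
  by apply: filterS => m; rewrite sub0r normrN.
have h3 : Normc.normc (expsum n (- z)) <= expR r.
  apply: le_trans (le_exp n); rewrite -lecR -normc_complex -expsum_real_complex.
  have := @norm_expsumB _ 0 n (- z) (leq0n n).
  by rewrite {2 4}/expsum !big_ord0 !subr0 normrN normc_complex.
have := norm_expsumM n z (- z); rewrite exp0 // normrN normc_complex -rmorphD.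
rewrite (normc_complex z) -/r !expsum_real_complex -rmorphM -rmorphB lecR.
apply/negP; rewrite -ltNge; apply: lt_le_trans h2 _.
have h4 : Normc.normc (expsum n z) * Normc.normc (expsum n (- z)) <= 2^-1.
  apply: le_trans (ler_pM (normc_ge0 _) (normc_ge0 _) (ltW h1) h3) _.
  by rewrite mulrAC mulVf ?mul1r // gt_eqF ?expR_gt0.
rewrite -lecR -normc_complex distrC.
apply: le_trans (lerB_dist _ _); rewrite normr1 normc_complex Normc.normcM.
by rewrite -(rmorph1 (real_complex R)) -rmorphB lecR lerBrDl; lra.
Unshelve. all: by end_near.
Qed.

(** * Reduction of overlaps to a real displacement *)

Lemma polar_normc (R : rcfType) (d : R[i]) : exists2 t : R[i],
  t * conjc t = 1 & d = t * (Normc.normc d)%:C%C.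
Proof.
have [->|d0] := eqVneq d 0.
  by exists 1; rewrite ?rmorph1 ?mul1r // Normc.normc0.
have n0 : (Normc.normc d)%:C%C != 0 :> R[i] by rewrite -normc_complex normr_eq0.
exists (d / (Normc.normc d)%:C%C); last by rewrite divfK.
have hc : conjc (Normc.normc d)%:C%C = (Normc.normc d)%:C%C by rewrite conjc_real.
move: n0 hc (normc_complex d); move: (Normc.normc d)%:C%C => n n0 hc hn.
rewrite fmorph_div /= hc mulrACA -invfM -[n * n]expr2 -hn -add_Re2_Im2.
have -> : d * conjc d = ((complex.Re d) ^+ 2 + (complex.Im d) ^+ 2)%:C%C.
  by case: (d) => x y; apply/eqP; rewrite eq_complex /=; apply/andP; split; apply/eqP; ring.
by rewrite divff // add_Re2_Im2 hn expf_neq0.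
Qed.

(* A Weyl operator with complex displacement d is conjugate, by a diagonal
   unitary, to the one with displacement |d|. *)
Lemma normc_wker (R : realType) (d : R[i]) k l :
  let w := Normc.normc d in
  Normc.normc (wker d (- conjc d) k l) ^+ 2 = wker w (- w) k l ^+ 2.
Proof.
move=> w; have [t ht hd] := polar_normc d.
have -> : wker d (- conjc d) k l =
    t ^+ k * conjc t ^+ l * (wker w (- w) k l)%:C%C.
  have hc : conjc d = conjc t * w%:C%C by rewrite {1}hd -[in RHS]conjc_real -rmorphM.
  rewrite hc {1}hd -mulrN -rmorphN wker_scale //.
  by rewrite wker_rmorph.
have t1 : Normc.normc t = 1.
  have /eqP : Normc.normc t ^+ 2 = 1.
    apply: complexI; rewrite rmorphXn /= -normc_complex -add_Re2_Im2 rmorph1 -ht.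
    by case: (t) => x y; apply/eqP; rewrite eq_complex /=; apply/andP; split; apply/eqP; ring.
  by rewrite sqrp_eq1 ?normc_ge0 // => /eqP.
have tc1 : Normc.normc (conjc t) = 1.
  by rewrite -t1; case: (t) => x y /=; rewrite sqrrN.
have X (z : R[i]) m : Normc.normc z = 1 -> Normc.normc (z ^+ m) = 1.
  move=> h; apply: complexI; rewrite -normc_complex normrX normc_complex h.
  by rewrite rmorph1 expr1n.
rewrite !Normc.normcM !X // !mul1r.
by rewrite /= expr0n addr0 sqr_sqrtr ?sqr_ge0.
Qed.

(** [c] collects the two Gaussian prefactors and the scalar exp(conj(a) b); square roots of
    factorials become factorials on squaring. *)
Lemma normc_weyl_inner1 (R : realType) (a b : R[i]) :
  let w := Normc.normc (b - a) in
  exists2 c : R, 0 < c & forall k l, Normc.normc (weyl_inner1 a b k l) ^+ 2 =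
    c * (k`!%:R * l`!%:R * wker w (- w) k l ^+ 2).
Proof.
move=> w; pose g (u : R[i]) : R := expR (- (Normc.normc u ^+ 2) / 2).
have [E E0 hE] := cvg_expsum_complex (conjc a * b).
have g0 u : 0 < g u by exact: expR_gt0.
exists ((g a * g b * Normc.normc E) ^+ 2).
  rewrite exprn_gt0 // !mulr_gt0 // lt_neqAle normc_ge0 andbT eq_sym.
  by apply: contra E0 => /eqP /Normc.eq0_normc ->.
move=> k l; pose C : R := g a * g b * (Num.sqrt k`!%:R * Num.sqrt l`!%:R).
have hT : series (fun m => conjc (weyl_el a m k) * weyl_el b m l : (R[i])^o) @ \oo -->
    (C%:C%C * (E * wker (- a + b) (- conjc b + conjc a) k l) : (R[i])^o).
  have -> : (fun m => conjc (weyl_el a m k) * weyl_el b m l : (R[i])^o) =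
      fun m => C%:C%C * (m`!%:R * wker (conjc a) (- a) m k * wker b (- conjc b) m l).
    apply/funext => m.
    have we u n : weyl_el u m n = (g u)%:C%C * (Num.sqrt m`!%:R * Num.sqrt n`!%:R)%:C%C
        * wker u (- conjc u) m n.
      by rewrite /weyl_el natrM sqrtrM ?ler0n.
    have cw : conjc (wker a (- conjc a) m k) = wker (conjc a) (- a) m k.
      by rewrite -wker_rmorph rmorphN /= conjcK.
    have cj (x y : R) z : conjc (x%:C%C * y%:C%C * z) = x%:C%C * y%:C%C * conjc z.
      by rewrite -[in RHS](conjc_real x) -[in RHS](conjc_real y) -!rmorphM.
    rewrite !we cj cw /C.
    have rM (x y : R) : (x * y)%:C%C = x%:C%C * y%:C%C by rewrite rmorphM.
    rewrite !rM.
    have : (Num.sqrt m`!%:R)%:C%C * (Num.sqrt m`!%:R)%:C%C = m`!%:R :> R[i].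
      by rewrite -rmorphM -expr2 sqr_sqrtr ?ler0n // rmorph_nat.
    move: (Num.sqrt m`!%:R)%:C%C => /= s hs.
    by rewrite -hs; ring.
  apply: cvg_seriesZ; apply: cvg_series_wker_mul.
  apply: cvg_trans hE; apply: near_eq_cvg; apply: nearW => n.
  by rewrite /series /= big_mkord.
rewrite /weyl_inner1 (cvg_lim _ hT); last exact: norm_hausdorff.
have -> : - conjc b + conjc a = - conjc (- a + b) by rewrite rmorphD rmorphN opprD opprK addrC.
rewrite addrC !Normc.normcM !exprMn normc_wker -/w.
have nr (x : R) : Normc.normc x%:C%C ^+ 2 = x ^+ 2.
  by rewrite /= expr0n addr0 sqr_sqrtr ?sqr_ge0.
rewrite nr /C !exprMn !sqr_sqrtr ?ler0n //.
by ring.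
Qed.

(** * Coherent-state lower bound and divergence of the double sum *)

Lemma cvg_series_divpow (R : realType) (t v : R) j :
  series (fun l => t ^+ l * divpow v l j : R^o) @ \oo --> (t ^+ j * expR (t * v) : R^o).
Proof.
elim: j => [|j IH].
  rewrite expr0 mul1r.
  rewrite (_ : (fun l => _) = exp_coeff (t * v)); first exact: is_cvg_series_exp_coeff.
  by apply/funext => l; rewrite /divpow /exp_coeff /= subn0 exprMn mulrA.
(* Raising j by one shifts the coefficients in l by one place, which multiplies the sum by t. *)
have := cvg_series_shift (cvg_seriesZ (a := t) IH).
rewrite mulrA -exprS; apply: cvg_trans; apply: near_eq_cvg; apply: nearW => n.
apply: eq_bigr => -[|l] _ /=; first by rewrite divpow0S mulr0.
by rewrite divpowSS exprS mulrA.
Qed.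

(** Setting Y = t in exp(uX + vY + XY) gives exp(tv) exp((u + t)X), whose coefficient of X^k is the
    limit. It is the pairing of row k with a coherent vector. *)
Lemma cvg_series_wker (R : realType) (u v t : R) k :
  series (fun l => t ^+ l * wker u v k l : R^o) @ \oo -->
  (expR (t * v) * ((u + t) ^+ k / k`!%:R) : R^o).
Proof.
pose f j : R := divpow u k j / j`!%:R.
have -> : expR (t * v) * ((u + t) ^+ k / k`!%:R) =
    \sum_(j < k.+1) f j * (t ^+ j * expR (t * v)).
  rewrite exprDn mulr_suml mulr_sumr; apply: eq_bigr => j _.
  have jk : (j <= k)%N by rewrite -ltnS.
  rewrite /f /divpow jk -mulr_natr.
  have h : ('C(k, j) * j`! * (k - j)`! = k`!)%N by rewrite -mulnA bin_fact.
  rewrite -h !natrM; field.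
  by rewrite !factr_neq0 /= pnatr_eq0 -lt0n bin_gt0.
have -> : series (fun l => t ^+ l * wker u v k l : R^o) =
    fun n => \sum_(j < k.+1) f j * series (fun l => t ^+ l * divpow v l j) n.
  apply/funext => n; rewrite /series /=.
  under [RHS]eq_bigr do rewrite mulr_sumr.
  rewrite [RHS]exchange_big /=; apply: eq_bigr => l _.
  rewrite (@wker_divpow _ _ _ _ _ k.+1) ?ltnS ?geq_minl // mulr_sumr.
  by apply: eq_bigr => j _; rewrite /f; ring.
apply: cvg_big => [|j _]; first exact: add_continuous.
 apply: cvgMl_tmp; exact: cvg_series_divpow.
Qed.

(** Cauchy-Schwarz gives the bound without the factor 1/2 in the limit; giving up that factor makes
    a finite [L] suffice. *)
Lemma wker_row_lower (R : realType) (w y : R) k : 0 <= w -> 1 <= y ->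
  exists L, y ^+ k * (k%:R ^+ k * expR (- k%:R)) / k`!%:R ^+ 2 / 2 <=
    \sum_(l < L) y ^+ l * (l`!%:R * wker w (- w) k l ^+ 2).
Proof.
move=> w0 y1; have y0 : 0 < y by exact: lt_le_trans y1.
(* The bound contains (tau - w)^(2k) exp(-(tau - w)^2 / y), maximal at (tau - w)^2 = k y. The
   pairing is taken at t = -tau, so that w + t = -rho. *)
pose rho := Num.sqrt (k%:R * y); pose tau := w + rho.
have rho0 : 0 <= rho by exact: sqrtr_ge0.
have rho2 : rho ^+ 2 = k%:R * y by rewrite sqr_sqrtr // mulr_ge0 // ltW.
pose S := expR (- tau * - w) * ((w + - tau) ^+ k / k`!%:R).
pose A := expR (tau ^+ 2 / y).
(* 2 lam S - lam^2 A <= sum is the linearised Cauchy-Schwarz inequality. *)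
pose lam := S / A.
pose Q L := 2 * lam * series (fun l => (- tau) ^+ l * wker w (- w) k l) L
  - lam ^+ 2 * expsum L (tau ^+ 2 / y).
have A0 : 0 < A by exact: expR_gt0.
have cQ : Q @ \oo --> S ^+ 2 / A.
  rewrite (_ : S ^+ 2 / A = 2 * lam * S - lam ^+ 2 * A); last first.
    by rewrite /lam; field; rewrite gt_eqF.
  apply: cvgB; apply: cvgMl_tmp; first exact: cvg_series_wker.
  exact: cvg_expsum.
set c := _ / _ ^+ 2.
have f0 : 0 < k`!%:R :> R by rewrite ltr0n fact_gt0.
have kk0 : 0 < k%:R ^+ k :> R by case: (k) => [|n]; rewrite ?expr0 // exprn_gt0 // ltr0n.
have c0 : 0 < c.
  rewrite divr_gt0 ?(exprn_gt0 2 f0) // mulr_gt0 ?(exprn_gt0 _ y0) //.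
  by rewrite mulr_gt0 ?expR_gt0.
have cS : c <= S ^+ 2 / A.
  rewrite /c /S /A exprMn -expRM_natl exprMn exprVn -exprM mulnC exprM.
  rewrite [(w + - tau) ^+ 2](_ : _ = k%:R * y); last by rewrite -rho2 /tau; ring.
  rewrite exprMn -expRN.
  rewrite [leRHS](_ : _ = y ^+ k * (k%:R ^+ k * expR (2%:R * (- tau * - w) - tau ^+ 2 / y))
    / k`!%:R ^+ 2); last by rewrite expRD; ring.
  rewrite ler_pM2r ?invr_gt0 ?exprn_gt0 // ler_pM2l ?exprn_gt0 // ler_pM2l // ler_expR.
  rewrite -subr_ge0.
  (* Since rho^2 / y = k, the last bracket vanishes; the rest is nonnegative because y >= 1 and w,
     rho >= 0. *)
  have -> : 2%:R * (- tau * - w) - tau ^+ 2 / y - - k%:R =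
      2 * w * (w + rho) - (w ^+ 2 + 2 * w * rho) / y + (k%:R - rho ^+ 2 / y).
    by rewrite /tau; field; rewrite gt_eqF.
  rewrite rho2 mulfK ?gt_eqF // subrr addr0 subr_ge0 ler_pdivrMr //.
  have : 0 <= w * (w + rho) by rewrite mulr_ge0 // addr_ge0.
  nra.
have : \forall L \near \oo, c / 2 < Q L.
  have h : c / 2 < S ^+ 2 / A by rewrite (lt_le_trans _ cS) // ltr_pdivrMr //; lra.
  exact: (cvgr_gt _ cQ _ h).
move=> [L _ /(_ L (leqnn L)) hL]; exists L; apply: le_trans (ltW hL) _.
rewrite /Q /series /= big_mkord /expsum !mulr_sumr -sumrB; apply: ler_sum => l _.
rewrite -subr_ge0.
(* Completing the square: with weight [d], each term of the difference is a square divided by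
   [d]. *)
pose d : R := y ^+ l * l`!%:R.
have d0 : 0 < d by rewrite mulr_gt0 ?exprn_gt0 // ltr0n fact_gt0.
rewrite [leRHS](_ : _ = (d * wker w (- w) k l - lam * (- tau) ^+ l) ^+ 2 / d).
  by rewrite divr_ge0 ?sqr_ge0 // ltW.
have -> : (tau ^+ 2 / y) ^+ l = ((- tau) ^+ l) ^+ 2 / y ^+ l.
  by rewrite expr_div_n -(sqrrN tau) -!exprM mulnC.
move: ((- tau) ^+ l) => s; rewrite /d; field.
by rewrite factr_neq0 expf_neq0 // gt_eqF.
Qed.

(** For k = n + 1 this is k^k e^(-k) / k! >= 1 / (e k). The induction step reduces to ((n + 1)/(n +
    2))^(n + 2) <= 1/e, from 1 - x <= exp(-x) at x = 1/(n + 2). *)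
Lemma fact_expR_le (R : realType) n :
  n.+1`!%:R * expR n%:R <= n.+1%:R ^+ n.+2 :> R.
Proof.
elim: n => [|n IH]; first by rewrite expR0 expr1n mulr1.
rewrite factS natrM -[in expR _]natr1 expRD.
apply: (@le_trans _ _ (n.+2%:R * (n.+1%:R ^+ n.+2 * expR 1))).
  by rewrite -mulrA ler_pM2l ?ltr0n // mulrA ler_pM2r ?expR_gt0.
rewrite [leRHS]exprS ler_pM2l ?ltr0n //.
rewrite -ler_pdivlMr ?expR_gt0 // -expRN.
have n2 : 0 < n.+2%:R :> R by rewrite ltr0n.
rewrite mulrC -ler_pdivrMr ?exprn_gt0 // -expr_div_n.
have -> : -1 = n.+2%:R * (- n.+2%:R^-1) :> R by rewrite mulrN mulfV ?gt_eqF.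
rewrite expRM_natl lerXn2r ?nnegrE ?expR_ge0 ?divr_ge0 //.
apply: le_trans (expR_ge1Dx _).
have -> : n.+1%:R = n.+2%:R - 1 :> R by rewrite -[n.+2%:R]natr1 addrK.
by rewrite mulrBl mulfV ?gt_eqF // mul1r.
Qed.

Lemma harmonic_sum_unbounded (R : realType) (B : R) :
  exists n, B <= \sum_(i < n) (i.+1%:R)^-1.
Proof.
apply: contrapT => h; apply: (@dvg_harmonic R).
apply: nondecreasing_is_cvgn.
  by apply: nondecreasing_series => i _ _; exact: harmonic_ge0.
exists B => _ [n _ <-]; rewrite leNgt; apply/negP => hB.
by apply: h; exists n; rewrite /series /= big_mkord in hB *; exact: ltW.
Qed.

(** The factor y^k of the row bound combines with x^k into (xy)^k >= 1, so row k contributes at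
    least a constant over k. *)
Lemma wker_double_sum_unbounded (R : realType) (w x y A : R) :
  0 <= w -> 0 < x -> 1 <= y -> 1 <= x * y ->
  exists N, A <= \sum_(k < N) \sum_(l < N)
    x ^+ k * y ^+ l * (k`!%:R * l`!%:R * wker w (- w) k l ^+ 2).
Proof.
move=> w0 x0 y1 xy1; have y0 : 0 < y by exact: lt_le_trans y1.
have [L hL] := choice (fun k => wker_row_lower k w0 y1).
(* The factor exp(-1) comes from [fact_expR_le], the 1/2 from [wker_row_lower]. *)
pose e : R := expR (-1) / 2.
have e0 : 0 < e by rewrite divr_gt0 ?expR_gt0.
have [n hn] := harmonic_sum_unbounded (A / e).
(* Large enough for the rows 1 to n and for the length each of them requires; row 0 is discarded, as
   1/k starts at k = 1. *)
pose N := maxn n.+1 (\max_(i < n) L i.+1).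
pose F k l := x ^+ k * y ^+ l * (k`!%:R * l`!%:R * wker w (- w) k l ^+ 2).
have F0 k l : 0 <= F k l.
  by rewrite (mulr_ge0 (mulr_ge0 _ _) (mulr_ge0 _ (sqr_ge0 _))) ?mulr_ge0 ?exprn_ge0 // ltW.
exists N; rewrite ler_pdivrMr // in hn; apply: (le_trans hn).
apply: (@le_trans _ _ (\sum_(i < n) \sum_(l < N) F i.+1 l)); last first.
  have nN : (n.+1 <= N)%N by exact: leq_maxl.
  rewrite -(big_mkord xpredT (fun k => \sum_(l < N) F k l)).
  rewrite (@big_cat_nat _ _ _ n.+1) //= big_mkord big_ord_recl.
  rewrite -[leLHS]add0r -[leLHS]addr0 !lerD ?sumr_ge0 // => i _; exact: sumr_ge0.
rewrite mulr_suml; apply: ler_sum => i _.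
have LN : (L i.+1 <= N)%N.
  by rewrite (leq_trans _ (leq_maxr _ _)) // (leq_bigmax (F := fun i : 'I_n => L i.+1)).
apply: (@le_trans _ _ (\sum_(l < L i.+1) F i.+1 l)); last first.
  rewrite -!(big_mkord xpredT (fun l => F i.+1 l)).
  by rewrite (@big_cat_nat _ _ _ (L i.+1) 0 N) //= lerDl sumr_ge0.
set k := i.+1.
have xk0 : 0 < x ^+ k * k`!%:R by rewrite mulr_gt0 ?exprn_gt0 // ltr0n fact_gt0.
rewrite (_ : \sum_(l < _) _ = x ^+ k * k`!%:R *
    \sum_(l < L k) y ^+ l * (l`!%:R * wker w (- w) k l ^+ 2)); last first.
  by rewrite mulr_sumr; apply: eq_bigr => l _; rewrite /F; ring.
have := hL k; rewrite -(ler_pM2l xk0); apply: le_trans.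
have f0 : 0 < k`!%:R :> R by rewrite ltr0n fact_gt0.
rewrite [leRHS](_ : _ = (x * y) ^+ k * (k%:R ^+ k * expR (- k%:R) / k`!%:R) / 2); last first.
  by rewrite exprMn; field; rewrite gt_eqF.
rewrite /e [leLHS]mulrA ler_pM2r ?invr_gt0 //.
have h : k%:R^-1 * expR (-1) <= k%:R ^+ k * expR (- k%:R) / k`!%:R :> R.
  have k0 : 0 < k%:R :> R by rewrite ltr0n.
  have i0 : 0 < expR i%:R :> R by exact: expR_gt0.
  have -> : expR (- k%:R) = (expR i%:R)^-1 * expR (-1) :> R.
    by rewrite -expRN -expRD /k -natr1 opprD.
  rewrite [leRHS](_ : _ = (k%:R ^+ k.+1 / (k`!%:R * expR i%:R)) * (k%:R^-1 * expR (-1))).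
    rewrite ler_peMl ?mulr_ge0 ?invr_ge0 ?expR_ge0 //.
    by rewrite ler_pdivlMr ?mulr_gt0 // mul1r; exact: fact_expR_le.
  by rewrite exprS; field; rewrite !gt_eqF.
apply: le_trans h _; rewrite ler_peMl ?exprn_ege1 //.
Qed.

(** * Reduction of the n-mode Renyi sum to a single mode *)

Definition single_mode {n : nat} (j0 : 'I_n) (k : nat) : {ffun 'I_n -> nat} :=
  [ffun j => if j == j0 then k else 0%N].

Lemma therm_ev_gt0 (R : realType) n (s : 'I_n -> R) k :
  (forall j, 0 < s j) -> 0 < therm_ev s k.
Proof.
move=> s0; apply: prodr_gt0 => j _.
by rewrite mulr_gt0 ?expR_gt0 // subr_gt0 expR_lt1 oppr_lt0.
Qed.

Lemma therm_ev_single_mode (R : realType) n (s : 'I_n -> R) j0 k :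
  therm_ev s (single_mode j0 k) =
  therm_ev s (single_mode j0 0) * expR (- (k%:R * s j0)).
Proof.
rewrite /therm_ev (bigD1 j0) //= [in RHS](bigD1 j0) //= !ffunE eqxx.
rewrite mul0r oppr0 expR0 mulr1 mulrAC; congr (_ * _ * _).
by apply: eq_bigr => j /negbTE jj0; rewrite !ffunE jj0.
Qed.

(** Every other mode contributes its vacuum overlap, which is nonzero because [wker] is 1 at (0,
    0). *)
Lemma weyl_overlap_single_mode (R : realType) n (u1 u2 : 'I_n -> R[i]) j0 :
  let w := Normc.normc (u2 j0 - u1 j0) in
  exists2 c : R, 0 < c & forall k l,
    Normc.normc (weyl_overlap u1 u2 (single_mode j0 k) (single_mode j0 l)) ^+ 2 =
    c * (k`!%:R * l`!%:R * wker w (- w) k l ^+ 2).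
Proof.
move=> w; have [c c0 hc] := normc_weyl_inner1 (u1 j0) (u2 j0).
pose d := \prod_(j < n | j != j0) Normc.normc (weyl_inner1 (u1 j) (u2 j) 0 0) ^+ 2.
exists (c * d).
  rewrite mulr_gt0 //; apply: prodr_gt0 => j _.
  have [e e0 ->] := normc_weyl_inner1 (u1 j) (u2 j).
  by rewrite wker00 fact0 expr1n !mulr1.
move=> k l; rewrite /weyl_overlap (big_morph _ (@Normc.normcM R) (@Normc.normc1 R)).
rewrite -prodrXl (bigD1 j0) //= !ffunE eqxx hc mulrAC; congr (_ * _ * _).
by apply: eq_bigr => j /negbTE jj0; rewrite !ffunE jj0.
Qed.

Lemma single_mode_inj n (j0 : 'I_n) : injective (single_mode j0).
Proof. by move=> k l /ffunP /(_ j0); rewrite !ffunE eqxx. Qed.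

Section RenyiSum.
Local Open Scope ereal_scope.

Lemma renyi_sum_eqy (R : realType) n (r s : 'I_n -> R) (u1 u2 : 'I_n -> R[i])
    (alpha : R) j0 :
  (forall j, 0 < s j)%R -> (forall j, 0 < r j)%R -> (1 < alpha)%R ->
  (alpha * r j0 <= (alpha - 1) * s j0)%R ->
  renyi_sum alpha (therm_ev r) (therm_ev s) (weyl_overlap u1 u2) = +oo.
Proof.
move=> s0 r0 a1 hj0; apply: eq_infty => B.
have [c c0 hc] := weyl_overlap_single_mode u1 u2 j0.
set w := Normc.normc (u2 j0 - u1 j0)%R in hc.
pose x : R := expR (- (alpha * r j0)); pose y : R := expR ((alpha - 1) * s j0).
pose D : R := (therm_ev r (single_mode j0 0) `^ alpha *
  therm_ev s (single_mode j0 0) `^ (1 - alpha) * c)%R.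
have D0 : (0 < D)%R by rewrite !mulr_gt0 // powR_gt0 // therm_ev_gt0.
have hterm k l : renyi_term alpha (therm_ev r) (therm_ev s) (weyl_overlap u1 u2)
    (single_mode j0 k, single_mode j0 l) =
    (D * (x ^+ k * y ^+ l * (k`!%:R * l`!%:R * wker w (- w) k l ^+ 2)))%:E.
  rewrite /renyi_term /= gt_eqF ?therm_ev_gt0 // -!EFinM hc; congr (_%:E).
  rewrite [therm_ev r _]therm_ev_single_mode [therm_ev s _]therm_ev_single_mode.
  rewrite !powRM ?expR_ge0 ?ltW ?therm_ev_gt0 // -!expRM /x /y -!expRM_natl.
  rewrite (_ : - (k%:R * r j0) * alpha = k%:R * - (alpha * r j0))%R; last by ring.
  rewrite (_ : - (l%:R * s j0) * (1 - alpha) = l%:R * ((alpha - 1) * s j0))%R; last by ring.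
  have AC p q a b v : (p * a * (q * b) * (c * v) = p * q * c * (a * b * v) :> R)%R by ring.
  exact: AC.
have [N hN] : exists N, (B / D <= \sum_(k < N) \sum_(l < N)
    x ^+ k * y ^+ l * (k`!%:R * l`!%:R * wker w (- w) k l ^+ 2))%R.
  apply: wker_double_sum_unbounded; rewrite ?normc_ge0 ?expR_gt0 //.
    by rewrite -[leLHS]expR0 ler_expR mulr_ge0 ?ltW // subr_gt0.
  by rewrite -expRD -[leLHS]expR0 ler_expR addrC subr_ge0.
(* [esum] is a supremum over finite index sets; by injectivity the image of the N by N square counts
   each term once. *)
pose e (kl : 'I_N * 'I_N) := (single_mode j0 kl.1, single_mode j0 kl.2).
have e_inj : injective e.
  by move=> [k l] [k' l'] [] /single_mode_inj /val_inj -> /single_mode_inj /val_inj ->.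
apply: esum_ge; exists [set` [seq e kl | kl <- enum {: 'I_N * 'I_N}]].
  by split => //; exact: finite_seq.
rewrite -fsbig_seq; last by rewrite map_inj_uniq ?enum_uniq.
rewrite big_map big_enum /=.
rewrite (eq_bigr _ (fun (kl : 'I_N * 'I_N) _ => hterm kl.1 kl.2)).
rewrite sumEFin lee_fin -(pair_bigA _ (fun k l : 'I_N =>
  D * (x ^+ k * y ^+ l * (k`!%:R * l`!%:R * wker w (- w) k l ^+ 2)))%R) /=.
rewrite ler_pdivrMr // in hN; apply: le_trans hN _.
rewrite mulr_suml; apply: ler_sum => k _; rewrite mulr_suml; apply: ler_sum => l _.
by rewrite mulrC.
Qed.

End RenyiSum.

(** * Monotonicity of coth and the order on covariance matrices *)

Lemma coth_lt (R : realType) (a b : R) : 0 < a -> a < b -> coth b < coth a.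
Proof.
move=> a0 ab; have b0 := lt_trans a0 ab.
have pos x : 0 < x -> 0 < expR x - expR (- x) by move=> ?; rewrite subr_gt0 ltr_expR; lra.
rewrite /coth ltr_pdivrMr ?pos // mulrAC ltr_pdivlMr ?pos //.
(* After clearing denominators the two sides differ by 2 (exp(b - a) - exp(a - b)). *)
have h : expR (a - b) < expR (b - a) by rewrite ltr_expR; lra.
by rewrite !expRD in h; nra.
Qed.

Lemma posdef_diag (R : realType) m (d : 'rV[R]_m) :
  (forall i, 0 < d 0 i) -> posdef (diag_mx d).
Proof.
move=> d0 x x0; rewrite mul_mx_diag mxE.
have E i : (\matrix_(i, j) ((x^T) i j * d 0 j)) ord0 i * x i ord0 = d 0 i * x i ord0 ^+ 2.
  by rewrite !mxE; ring.
under eq_bigr do rewrite E.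
have [i xi] : exists i, x i ord0 != 0.
  apply/existsP; apply: contraNT x0; rewrite negb_exists => /forallP h.
  by apply/eqP/matrixP => i j; rewrite ord1 mxE; apply/eqP; rewrite -[_ == _]negbK h.
rewrite (bigD1 i) //=; apply: ltr_wpDr; last by rewrite mulr_gt0 ?exprn_even_gt0.
by apply: sumr_ge0 => j _; rewrite mulr_ge0 ?sqr_ge0 // ltW.
Qed.

(** In diagonal form, positive definiteness of a difference of covariance matrices becomes an
    entrywise inequality. *)
Lemma gauss_cov_diag (R : realType) n (s : 'I_n -> R) :
  gauss_cov s = diag_mx (\row_i (2^-1 * coth (s (mxtens_unindex i).1 / 2))).
Proof.
apply/matrixP => i j; rewrite !mxE.
have [->|ij] := eqVneq i j; first by rewrite !eqxx mulr1.
have [e1|_] := eqVneq (mxtens_unindex i).1 (mxtens_unindex j).1; last first.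
  by rewrite !mulr0n mul0r mulr0.
have [e2|_] := eqVneq (mxtens_unindex i).2 (mxtens_unindex j).2; last first.
  by rewrite !mulr0.
have /(can_inj (@mxtens_unindexK n 2)) : mxtens_unindex i = mxtens_unindex j.
  by rewrite [LHS]surjective_pairing e1 e2 -surjective_pairing.
by move/eqP; rewrite (negbTE ij).
Qed.

Lemma mx_gt_gauss_cov (R : realType) n (s t : 'I_n -> R) :
  (forall j, 0 < s j) -> (forall j, s j < t j) -> mx_gt (gauss_cov s) (gauss_cov t).
Proof.
move=> s0 st; rewrite /mx_gt !gauss_cov_diag -raddfB; apply: posdef_diag => i.
rewrite !mxE -mulrBr mulr_gt0 ?invr_gt0 // subr_gt0 coth_lt ?divr_gt0 //.
by rewrite ltr_pM2r ?invr_gt0.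
Qed.

Unset Implicit Arguments.
(* rho   = W(u1) gamma(r) W(u1)^dag : spectral decomposition with
          eigenvectors W(u1)|k>, eigenvalues therm_ev r k;
   sigma = W(u2) gamma(s) W(u2)^dag : eigenvectors W(u2)|l>,
          eigenvalues therm_ev s l;  overlaps <W(u1)k|W(u2)l>. *)
Theorem theorem3p7 (R : realType) (n : nat) (r s : 'I_n -> R)
    (u1 u2 : 'I_n -> R[i]) (alpha : R) :
  (forall j, 0 < r j) -> (forall j, 0 < s j) -> 1 < alpha ->
  (renyi_div alpha (therm_ev r) (therm_ev s) (weyl_overlap u1 u2) < +oo)%E ->
  mx_gt (cov_power (alpha - 1) s) (cov_power alpha r).
Proof.
move=> r0 s0 a1 hfin; apply: mx_gt_gauss_cov => j.
  by rewrite mulr_gt0 // subr_gt0.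
rewrite ltNge; apply/negP => h; move: hfin.
by rewrite /renyi_div (renyi_sum_eqy u1 u2 s0 r0 a1 h) a1 ltxx.
Qed.
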